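(* Let $\nu\in(0,1]$ and $p=1+\nu$. Let $f:\mathbb{R}^n\to\mathbb{R}$ be Fréchet differentiable with $\nu$-Hölder continuous gradient on $\mathbb{R}^n$ with constant $L_\nu$, and let $g:\mathbb{R}^n\to\mathbb{R}\cup\{+\infty\}$ be proper, lower semicontinuous, and high-order prox-bounded of order $p$ with threshold $\gamma^{g,p}>0$. Set $\varphi:=f+g$. Then, for each $r>0$, there exists $\overline{\gamma}_r\in(0,\gamma^{g,p})$ such that, for every $\gamma\in(0,\overline{\gamma}_r)$, there exists a constant $\mathcal{L}_{\nu,r,\gamma}>0$ satisfying $$|\varphi_\gamma^p(z)-\varphi_\gamma^p(x)|\le\mathcal{L}_{\nu,r,\gamma}\|z-x\|^\nu,\qquad\forall x,z\in\mathbf{B}(0;r).$$ In particular, $\varphi_\gamma^p$ is Hölder continuous of order $\nu$ on $\mathbf{B}(0;r)$ for every $\gamma\in(0,\overline{\gamma}_r)$.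
   Context: $\|\cdot\|$ and $\langle\cdot,\cdot\rangle$ are the Euclidean norm and inner product on $\mathbb{R}^n$; $\mathbf{B}(\overline{x};r)$ is the open ball with center $\overline{x}$ and radius $r$. A function $h:\mathbb{R}^n\to\mathbb{R}\cup\{+\infty\}$ is proper if it is finite at some point. $f$ has a $\nu$-Hölder continuous gradient with constant $L_\nu\ge 0$ if $\|\nabla f(y)-\nabla f(x)\|\le L_\nu\|y-x\|^\nu$ for all $x,y\in\mathbb{R}^n$. A proper function $g$ is high-order prox-bounded of order $p>1$ if there exist $\gamma>0$ and $x\in\mathbb{R}^n$ with $\inf_{y\in\mathbb{R}^n}\{g(y)+\frac{1}{p\gamma}\|x-y\|^p\}>-\infty$; the supremum of all such $\gamma$ is the threshold $\gamma^{g,p}\in(0,+\infty]$. For $\gamma>0$, the high-order forward-backward envelope (HiFBE) of $\varphi=f+g$ is $$\varphi_\gamma^p(x):=\inf_{y\in\mathbb{R}^n}\left\{f(x)+\langle\nabla f(x),y-x\rangle+g(y)+\frac{1}{p\gamma}\|x-y\|^p\right\}.$$ *)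

(* Defs.v *)
From HB Require Import structures.
From mathcomp Require Import all_boot all_order all_algebra.
From mathcomp Require Import all_classical all_reals all_analysis.

Set Implicit Arguments.
Unset Strict Implicit.
Unset Printing Implicit Defensive.

Import Order.TTheory GRing.Theory Num.Theory.
Import numFieldNormedType.Exports.

Local Open Scope classical_set_scope.
Local Open Scope ring_scope.

(* The library norm on 'rV[R]_n is the sup norm, hence the Euclidean
   structure below. Since all norms on R^n are equivalent, [differentiable],
   ['d f x] and [lower_semicontinuous] do not depend on this choice. *)
Section Euclidean.
Context {R : realType} {n : nat}.
Implicit Types (u v x : 'rV[R]_n) (f : 'rV[R]_n -> R).

Definition dot u v : R := \sum_i u 0 i * v 0 i.

Definition enorm u : R := Num.sqrt (dot u u).

Definition eball x (r : R) : set 'rV[R]_n := [set y | enorm (y - x) < r].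

(* The Riesz representer of the Frechet derivative of f at x. *)
Definition grad f x : 'rV[R]_n := \row_i 'd f x (delta_mx 0 i).

Lemma dot_grad f x v : dot (grad f x) v = 'd f x v.
Proof.
rewrite {2}(row_sum_delta v) linear_sum /dot.
by apply: eq_bigr => i _; rewrite linearZ mxE mulrC.
Qed.

Definition holder_gradient (nu L : R) f : Prop :=
  forall x y, enorm (grad f y - grad f x) <= L * enorm (y - x) `^ nu.

Definition holder_continuous_on (nu : R) (A : set 'rV[R]_n) f : Prop :=
  exists2 L : R, 0 <= L &
    forall x z, A x -> A z -> `|f z - f x| <= L * enorm (z - x) `^ nu.

End Euclidean.

Section Envelope.
Context {R : realType} {n : nat}.
Implicit Types (x y : 'rV[R]_n) (f : 'rV[R]_n -> R) (g : 'rV[R]_n -> \bar R).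
Local Open Scope ereal_scope.

Definition proper_fun g : Prop := exists x, g x \is a fin_num.

Definition moreau_env (p gamma : R) g x : \bar R :=
  ereal_inf (range (fun y =>
    g y + ((p * gamma)^-1 * enorm (x - y) `^ p)%:E)).

Definition prox_bounded_with (p : R) g (gamma : R) : Prop :=
  (0 < gamma)%R /\ exists x, -oo < moreau_env p gamma g x.

Definition prox_bounded (p : R) g : Prop :=
  exists gamma, prox_bounded_with p g gamma.

Definition prox_threshold (p : R) g : \bar R :=
  ereal_sup (EFin @` prox_bounded_with p g).

Definition hifbe (p gamma : R) f g x : \bar R :=
  ereal_inf (range (fun y =>
    (f x)%:E + (dot (grad f x) (y - x))%:E + g y
    + ((p * gamma)^-1 * enorm (x - y) `^ p)%:E)).

End Envelope.

(* Main.v *)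
(* Prox-boundedness with parameter gamma0 bounds g(y) from below by
   m - k0 |x0 - y|^p.  Since |x0 - y|^p <= 2 (|x0 - x|^p + |x - y|^p) for
   p = 1 + nu <= 2, as soon as gamma < gamma0 / 2 the model minimized in the
   envelope is bounded below by A + c |x - y|^p - G |x - y| with c > 0,
   uniformly for x in the ball.  Hence the infimum is finite and may be taken
   over y within a distance T of x that does not depend on x.  For such y the
   models at x and z differ by O(|z - x|^nu): the terms in f and its gradient
   by the Hoelder hypothesis and the mean value theorem, and the power term
   because t^nu is subadditive. *)
Require Import Defs.
From HB Require Import structures.
From mathcomp Require Import all_boot all_order all_algebra.
From mathcomp Require Import ring lra.
From mathcomp Require Import all_classical all_reals all_analysis.
Import Order.TTheory GRing.Theory Num.Theory.
Import numFieldNormedType.Exports.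
Local Open Scope classical_set_scope.
Local Open Scope ring_scope.

(** * Real-power inequalities for the exponents [nu] and [1 + nu] *)

Section PowR.
Context {R : realType}.
Implicit Types a b c t nu : R.

Lemma powR1D a nu : 0 <= a -> 0 <= nu -> a `^ (1 + nu) = a * a `^ nu.
Proof.
move=> a0 nu0; rewrite -(mulr_powRB1 a0 (_ : 0 < 1 + nu)) ?ltr_pwDl//.
by rewrite addrAC subrr add0r.
Qed.

(** For [c] equal to [a] or [b], the ratio [c / (a + b)] lies in [0, 1], so raising it to a power at
    most 1 does not decrease it. The two ratios sum to 1. *)
Lemma powR_subadd a b nu : 0 <= a -> 0 <= b -> 0 < nu -> nu <= 1 ->
  (a + b) `^ nu <= a `^ nu + b `^ nu.
Proof.
move=> a0 b0 nu0 nu1.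
have [ab0|ab0] := eqVneq (a + b) 0.
  by rewrite ab0 powR0 ?gt_eqF// addr_ge0 ?powR_ge0.
have abp : 0 < a + b by rewrite lt_neqAle eq_sym ab0 addr_ge0.
have le_powR c : 0 <= c -> c <= a + b -> c / (a + b) * (a + b) `^ nu <= c `^ nu.
  move=> c0 cab; have [->|cn0] := eqVneq c 0; first by rewrite !mul0r powR_ge0.
  have q0 : 0 < c / (a + b) <= 1.
    by rewrite ler_pdivrMr// mul1r cab andbT divr_gt0// lt_neqAle eq_sym cn0.
  have -> : c `^ nu = (c / (a + b)) `^ nu * (a + b) `^ nu.
    by rewrite -powRM ?divfK// ?divr_ge0// ltW.
  by rewrite ler_wpM2r ?powR_ge0// ger1_powR.
have := lerD (le_powR a a0 (ler_wpDr b0 (lexx _)))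
  (le_powR b b0 (ler_wpDl a0 (lexx _))).
by rewrite -mulrDl -mulrDl divff// mul1r.
Qed.

(** After subadditivity, the remaining gap is [(a - b) * (a]^ nu - b [^ nu)], whose factors have the
    same sign by monotonicity. *)
Lemma powR1D_add_le a b nu : 0 <= a -> 0 <= b -> 0 < nu -> nu <= 1 ->
  (a + b) `^ (1 + nu) <= 2 * (a `^ (1 + nu) + b `^ (1 + nu)).
Proof.
move=> a0 b0 nu0 nu1; rewrite !powR1D ?addr_ge0 ?(ltW nu0)//.
have sub := ler_wpM2l (addr_ge0 a0 b0) (@powR_subadd a b nu a0 b0 nu0 nu1).
suff : 0 <= (a - b) * (a `^ nu - b `^ nu) by lra.
have mono := @ge0_ler_powR R nu (ltW nu0).
have [ab|/ltW ba] := leP a b.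
  by rewrite -mulrNN !opprB mulr_ge0 ?subr_ge0// mono ?nnegrE.
by rewrite mulr_ge0 ?subr_ge0// mono ?nnegrE.
Qed.

Lemma powR1D_sub_le a b t nu : 0 <= a -> 0 <= b -> 0 <= t -> 0 < nu -> nu <= 1 ->
  a <= b + t ->
  a `^ (1 + nu) - b `^ (1 + nu) <= (b + t) * t `^ nu + t * b `^ nu.
Proof.
move=> a0 b0 t0 nu0 nu1 abt; have bt0 := addr_ge0 b0 t0.
have le1 : a `^ (1 + nu) <= (b + t) `^ (1 + nu).
  by rewrite ge0_ler_powR ?nnegrE// addr_ge0// ltW.
rewrite !powR1D ?(ltW nu0)// in le1 *.
have := ler_wpM2l bt0 (@powR_subadd b t nu b0 t0 nu0 nu1); lra.
Qed.

(** Split [t] as [t]^ (1 - nu) * t [^ nu]. This turns Lipschitz terms into Hölder terms on bounded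
    sets. *)
Lemma ler_powR_bounded t c nu : 0 <= t -> t <= c -> 0 < nu -> nu <= 1 ->
  t <= c `^ (1 - nu) * t `^ nu.
Proof.
move=> t0 tc nu0 nu1.
rewrite -{1}[t](powRr1 t0) -[X in t `^ X](subrK nu) powRD; last first.
  by rewrite subrK oner_eq0.
by rewrite ler_wpM2r ?powR_ge0// ge0_ler_powR ?nnegrE ?subr_ge0// (le_trans t0).
Qed.

Lemma powR1D_coercive c G nu B : 0 < c -> 0 <= G -> 0 < nu ->
  exists T, forall t, 0 <= t -> c * t `^ (1 + nu) - G * t <= B -> t <= T.
Proof.
move=> c0 G0 nu0; exists (Num.max (((G + 1) / c) `^ nu^-1) B) => t t0 tB.
rewrite le_max; have [//|/= /ltW lt] := leP t.
apply: le_trans tB.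
have q0 : 0 <= (G + 1) / c by rewrite divr_ge0 ?addr_ge0// ltW.
have : (G + 1) / c <= t `^ nu.
  have := @ge0_ler_powR R nu (ltW nu0) _ _ _ _ lt.
  by rewrite -powRrM mulVf ?gt_eqF// powRr1// => -> //; rewrite nnegrE// powR_ge0.
rewrite ler_pdivrMr// powR1D ?(ltW nu0)// => h.
have := ler_wpM2l t0 h; lra.
Qed.

Lemma powR1D_bounded_below c G nu : 0 < c -> 0 <= G -> 0 < nu ->
  exists m, forall t, 0 <= t -> m <= c * t `^ (1 + nu) - G * t.
Proof.
move=> c0 G0 nu0; have [T hT] := @powR1D_coercive c G nu 0 c0 G0 nu0.
exists (- (G * `|T|)) => t t0.
have [/(hT _ t0) tT|/ltW pos] := leP (c * t `^ (1 + nu) - G * t) 0.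
  have := ler_wpM2l G0 (le_trans tT (ler_norm T)).
  have := mulr_ge0 (ltW c0) (powR_ge0 t (1 + nu)); lra.
by rewrite (le_trans _ pos)// oppr_le0 mulr_ge0.
Qed.

End PowR.

(** * Inner product algebra, Cauchy-Schwarz and the triangle inequality *)

Section EuclideanNorm.
Context {R : realType} {n : nat}.
Implicit Types u v w x y z : 'rV[R]_n.

Lemma dotC u v : dot u v = dot v u.
Proof. by apply: eq_bigr => i _; rewrite mulrC. Qed.

Lemma dotDl u v w : dot (u + v) w = dot u w + dot v w.
Proof. by rewrite -big_split; apply: eq_bigr => i _; rewrite mxE mulrDl. Qed.

Lemma dotZl (a : R) u v : dot (a *: u) v = a * dot u v.
Proof. by rewrite mulr_sumr; apply: eq_bigr => i _; rewrite mxE mulrA. Qed.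

Lemma dotNl u v : dot (- u) v = - dot u v.
Proof. by rewrite -scaleN1r dotZl mulN1r. Qed.

Lemma dotDr u v w : dot u (v + w) = dot u v + dot u w.
Proof. by rewrite !(dotC u) dotDl. Qed.

Lemma dotZr (a : R) u v : dot u (a *: v) = a * dot u v.
Proof. by rewrite !(dotC u) dotZl. Qed.

Lemma dotNr u v : dot u (- v) = - dot u v.
Proof. by rewrite !(dotC u) dotNl. Qed.

Lemma dot_sub_sub u v x y z :
  dot u (y - z) - dot v (y - x) = dot (u - v) (y - z) + dot v (x - z).
Proof. by rewrite !(dotDl, dotDr, dotNl, dotNr); ring. Qed.

Lemma dotuu_ge0 u : 0 <= dot u u.
Proof. by apply: sumr_ge0 => i _; rewrite -expr2 sqr_ge0. Qed.

Lemma enorm_ge0 u : 0 <= enorm u.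
Proof. exact: sqrtr_ge0. Qed.

Lemma enorm_sqr u : enorm u ^+ 2 = dot u u.
Proof. by rewrite sqr_sqrtr// dotuu_ge0. Qed.

Lemma enormN u : enorm (- u) = enorm u.
Proof. by rewrite /enorm dotNl dotNr opprK. Qed.

Lemma enormB u v : enorm (u - v) = enorm (v - u).
Proof. by rewrite -enormN opprB. Qed.

Lemma enormZ (a : R) u : enorm (a *: u) = `|a| * enorm u.
Proof.
by rewrite /enorm dotZl dotZr mulrA -expr2 sqrtrM ?sqr_ge0// sqrtr_sqr.
Qed.

Lemma enorm_eq0 u : enorm u = 0 -> u = 0.
Proof.
move=> u0; have := enorm_sqr u; rewrite u0 expr0n /= => /esym.
move/(psumr_eq0P (fun i _ => sqr_ge0 (u 0 i) : 0 <= u 0 i * u 0 i)) => h.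
apply/rowP => i; rewrite mxE; apply/eqP.
by have /eqP := h i isT; rewrite mulf_eq0 orbb.
Qed.

Lemma dot_le u v : dot u v <= enorm u * enorm v.
Proof.
have [/enorm_eq0 ->|u0] := eqVneq (enorm u) 0.
  by rewrite -(scale0r 0) dotZl mul0r mulr_ge0 ?enorm_ge0.
have [/enorm_eq0 ->|v0] := eqVneq (enorm v) 0.
  by rewrite -(scale0r 0) dotZr mul0r mulr_ge0 ?enorm_ge0.
have uv0 : 0 < enorm u * enorm v.
  by rewrite lt_neqAle eq_sym mulf_neq0//= mulr_ge0 ?enorm_ge0.
(* The square expands to [2 * |u| * |v| * (|u| * |v| - dot u v)]; the positive factor [|u| * |v|]
   then cancels. *)
have := dotuu_ge0 (enorm v *: u - enorm u *: v).
rewrite !(dotDl, dotDr, dotNl, dotNr, dotZl, dotZr) -!enorm_sqr (dotC v u) => h.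
rewrite -(ler_pM2l uv0); lra.
Qed.

Lemma normr_dot_le u v : `|dot u v| <= enorm u * enorm v.
Proof. by rewrite ler_norml dot_le andbT lerNl -dotNl -(enormN u) dot_le. Qed.

Lemma enormD u v : enorm (u + v) <= enorm u + enorm v.
Proof.
rewrite -(@ler_pXn2r _ 2) ?nnegrE ?addr_ge0 ?enorm_ge0//.
rewrite sqrrD !enorm_sqr !(dotDl, dotDr) (dotC v u).
have := dot_le u v; lra.
Qed.

End EuclideanNorm.

(** * Mean value theorem along segments and Lipschitz bounds on balls *)

Section MeanValue.
Context {R : realType} {n : nat}.
Implicit Types (x v z : 'rV[R]_n) (f : 'rV[R]_n -> R).

(** The one-variable mean value theorem applies to [f] restricted to the segment [l]; the chain rule
    identifies the derivative. *)
Lemma differentiable_mean_value f x v : (forall y, differentiable f y) ->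
  exists2 t : R, t \in `[0, 1] & f (x + v) - f x = dot (grad f (x + t *: v)) v.
Proof.
move=> df; pose l (t : R) : 'rV[R]_n := x + t *: v.
have dl (t : R) : is_derive t 1 l v.
  have sd := @is_diff_scalel R 'rV[R]_n t v.
  have dsv : is_derive t 1 ( *:%R^~ v) v.
    apply: DeriveDef; first by apply: diff_derivable; case: sd.
    rewrite deriveE; last by case: sd.
    by rewrite (diff_val (is_diff_def := sd)) scale1r.
  by have := is_deriveD (is_derive_cst x t 1) dsv; rewrite add0r.
have dfl (t : R) : is_derive t 1 (f \o l) (dot (grad f (l t)) v).
  have dlt : differentiable l t by apply/derivable1_diffP; case: (dl t).
  have dc : differentiable (f \o l) t by exact: differentiable_comp.
  apply: DeriveDef; first exact/derivable1_diffP.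
  rewrite (deriveE (1 : R) dc) (diff_comp dlt (df (l t))) [LHS]/= dot_grad.
  by rewrite -(deriveE (1 : R) dlt) (@derive_val _ _ _ _ _ _ _ (dl t)).
have cfl : {within `[0, 1], continuous (f \o l)}.
  apply: continuous_subspaceT => t; apply: differentiable_continuous.
  by apply/derivable1_diffP; case: (dfl t).
have [t t01] := MVT_segment ler01 (fun t _ => dfl t) cfl.
rewrite subr0 mulr1 => ft; exists t => //.
by rewrite -[RHS]ft -[RHS]/(f (l 1) - f (l 0)) /l scale1r scale0r addr0.
Qed.

(** Convexity of the ball: it keeps the intermediate point of the mean value theorem where the
    gradient bound holds. *)
Lemma enorm_segment_lt r x v (t : R) : t \in `[0, 1] ->
  enorm x < r -> enorm (x + v) < r -> enorm (x + t *: v) < r.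
Proof.
rewrite in_itv /= => /andP[t0 t1] xr xvr.
have -> : x + t *: v = (1 - t) *: x + t *: (x + v).
  by rewrite scalerDr addrA -scalerDl subrK scale1r.
apply: le_lt_trans (enormD _ _) _; rewrite !enormZ !ger0_norm ?subr_ge0//.
set m := Num.max (enorm x) (enorm (x + v)).
have mr : m < r by rewrite gt_max xr.
have xm : enorm x <= m by rewrite le_max lexx.
have xvm : enorm (x + v) <= m by rewrite le_max lexx orbT.
apply: le_lt_trans mr; rewrite -subr_ge0 in t1.
have := lerD (ler_wpM2l t1 xm) (ler_wpM2l t0 xvm).
by rewrite -mulrDl subrK mul1r.
Qed.

Lemma grad_bounded nu L f r x : 0 <= nu -> 0 <= L -> holder_gradient nu L f ->
  enorm x <= r -> enorm (grad f x) <= enorm (grad f 0) + L * r `^ nu.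
Proof.
move=> nu0 L0 hf xr; rewrite -[grad f x](subrK (grad f 0)) addrC.
apply: le_trans (enormD _ _) _; rewrite lerD2l.
apply: le_trans (hf _ _) _.
rewrite subr0 ler_wpM2l// ge0_ler_powR ?nnegrE ?enorm_ge0//.
exact: le_trans (enorm_ge0 x) xr.
Qed.

Lemma lipschitz_on_ball f r G x z : (forall y, differentiable f y) ->
  (forall y, enorm y < r -> enorm (grad f y) <= G) ->
  enorm x < r -> enorm z < r -> `|f z - f x| <= G * enorm (z - x).
Proof.
move=> df gG xr zr; have [t t01] := @differentiable_mean_value f x (z - x) df.
have xzx : x + (z - x) = z by rewrite addrC subrK.
rewrite xzx => ->; apply: le_trans (normr_dot_le _ _) _.
by rewrite ler_wpM2r ?enorm_ge0// gG// enorm_segment_lt// xzx.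
Qed.

End MeanValue.

(** * Comparison of infima of extended-real functions *)

Section Infimum.
Context {R : realType} {T : Type}.
Implicit Types F H : T -> \bar R.
Local Open Scope ereal_scope.

(** Points with [F y >= B] do not matter: some [y0] has [F y0 < B], and the comparison at [y0]
    already gives the bound for them. This localizes the minimization. *)
Lemma ereal_inf_le_sublevel F H (B K : R) : ereal_inf (range F) < B%:E ->
  (forall y, F y < B%:E -> H y <= F y + K%:E) ->
  ereal_inf (range H) <= ereal_inf (range F) + K%:E.
Proof.
move=> FB FH; rewrite -leeBlDr//; apply/ereal_infP => _ [y _ <-].
rewrite leeBlDr//; have [FyB|ByF] := ltP (F y) B%:E.
  by apply: le_trans (FH _ FyB); apply: ereal_inf_lbound; exists y.
have [_ [y0 _ <-] Fy0] := ereal_inf_lt FB.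
apply: (@le_trans _ _ (H y0)); first by apply: ereal_inf_lbound; exists y0.
apply: le_trans (FH _ Fy0) _.
by rewrite leeD2r// (le_trans (ltW Fy0)).
Qed.

Lemma fineB_le (a b : \bar R) (K : R) : a \is a fin_num -> b \is a fin_num ->
  a <= b + K%:E -> (fine a - fine b <= K)%R.
Proof. by case: a b => [a| |] [b| |]//= _ _; rewrite lee_fin lerBlDl. Qed.

Lemma leeD2l_EFin (x : \bar R) (a b K : R) :
  (b - a <= K)%R -> x + b%:E <= x + a%:E + K%:E.
Proof. by rewrite lerBlDl => baK; rewrite -addeA -EFinD leeD2l// lee_fin. Qed.

End Infimum.

(** * The function minimized in the envelope: variation and two-sided bounds *)

Section Model.
Context {R : realType} {n : nat}.
Implicit Types (x y z : 'rV[R]_n) (f : 'rV[R]_n -> R) (g : 'rV[R]_n -> \bar R).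

(** The term [g y] is left out: the rest is real-valued, and [g y], being independent of [x], is
    common to the models compared. *)
Definition hifbe_model (p gamma : R) f x y : R :=
  f x + dot (grad f x) (y - x) + (p * gamma)^-1 * enorm (x - y) `^ p.

Lemma hifbeE (p gamma : R) f g x : hifbe p gamma f g x =
  ereal_inf (range (fun y => (g y + (hifbe_model p gamma f x y)%:E)%E)).
Proof.
rewrite /hifbe; congr ereal_inf; apply: eq_imagel => y _.
by rewrite -EFinD addeAC -EFinD addeC.
Qed.

Lemma hifbe_model_holder nu L f gamma G D T x y z :
  0 < nu -> nu <= 1 -> 0 <= L -> holder_gradient nu L f -> 0 < gamma ->
  enorm (grad f x) <= G -> f z - f x <= G * enorm (z - x) ->
  enorm (z - x) <= D -> enorm (x - y) <= T ->
  hifbe_model (1 + nu) gamma f z y - hifbe_model (1 + nu) gamma f x y <=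
  (2 * G * D `^ (1 - nu) + L * (T + D)
   + ((1 + nu) * gamma)^-1 * (T + D + D `^ (1 - nu) * T `^ nu))
  * enorm (z - x) `^ nu.
Proof.
move=> nu0 nu1 L0 /(_ x z) hf gamma0 xG fzx zxD xyT; rewrite /hifbe_model.
move: (f z) (f x) (grad f z) (grad f x) hf xG fzx => fz fx u v uv xG fzx.
have p0 : 0 < 1 + nu by rewrite ltr_pwDl// ltW.
have k0 : 0 <= ((1 + nu) * gamma)^-1 by rewrite invr_ge0 ltW// mulr_gt0.
have d0 := enorm_ge0 (z - x); have t0 := enorm_ge0 (x - y).
have G0 := le_trans (enorm_ge0 _) xG.
have zy_le : enorm (z - y) <= enorm (x - y) + enorm (z - x).
  by rewrite [leRHS]addrC (le_trans _ (enormD _ _))// addrA subrK.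
have dD := @ler_powR_bounded R _ _ _ d0 zxD nu0 nu1.
have gradz : dot (u - v) (y - z)
    <= L * (T + D) * enorm (z - x) `^ nu.
  apply: le_trans (dot_le _ _) _; rewrite mulrAC.
  apply: ler_pM; rewrite ?enorm_ge0//.
  by rewrite enormB (le_trans zy_le)// lerD.
have gradx : dot (v) (x - z) <= G * enorm (z - x).
  by apply: le_trans (dot_le _ _) _; rewrite (enormB x z) ler_wpM2r.
have prox := @powR1D_sub_le R _ _ _ _ (enorm_ge0 (z - y)) t0 d0 nu0 nu1 zy_le.
have Gd := ler_wpM2l G0 dD.
have prox_le : ((1 + nu) * gamma)^-1 *
    (enorm (z - y) `^ (1 + nu) - enorm (x - y) `^ (1 + nu)) <=
    ((1 + nu) * gamma)^-1 * ((T + D + D `^ (1 - nu) * T `^ nu)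
    * enorm (z - x) `^ nu).
  apply: (ler_wpM2l k0); apply: le_trans prox _; rewrite [leRHS]mulrDl.
  apply: lerD; first by rewrite ler_wpM2r ?powR_ge0// lerD.
  rewrite mulrAC ler_pM ?powR_ge0// ge0_ler_powR ?nnegrE ?(ltW nu0)//.
  exact: le_trans t0 xyT.
move: fzx Gd gradz gradx prox_le (dot_sub_sub u v x y z).
move: (dot v (x - z)) (dot (u - v) (y - z)) (dot u (y - z)) (dot v (y - x)).
clear; move: (enorm (z - x)) (enorm (x - y)) (enorm (z - y)) => d t s.
move: (d `^ nu) (t `^ (1 + nu)) (s `^ (1 + nu)) => *; lra.
Qed.

(** The lower bound on [g] is centred at [x0], the model at [x]. Recentring by [powR1D_add_le] costs
    the factor 2 on [k0]; Cauchy-Schwarz handles the gradient term. *)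
Lemma hifbe_model_ge nu f g gamma k0 m D G x0 x y :
  0 < nu -> nu <= 1 -> 0 <= k0 -> enorm (x0 - x) <= D -> enorm (grad f x) <= G ->
  (m%:E <= g y + (k0 * enorm (x0 - y) `^ (1 + nu))%:E)%E ->
  ((m - 2 * k0 * D `^ (1 + nu) + f x
    + ((((1 + nu) * gamma)^-1 - 2 * k0) * enorm (x - y) `^ (1 + nu)
       - G * enorm (x - y)))%:E
   <= g y + (hifbe_model (1 + nu) gamma f x y)%:E)%E.
Proof.
move=> nu0 nu1 k00 x0D xG.
case: (g y) => [a| |]; rewrite ?addye ?addNye ?leey// -!EFinD !lee_fin => ma.
have x0y : enorm (x0 - y) `^ (1 + nu) <=
    2 * (D `^ (1 + nu) + enorm (x - y) `^ (1 + nu)).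
  have p0 : 0 <= 1 + nu by rewrite addr_ge0// ltW.
  have D0 := le_trans (enorm_ge0 _) x0D.
  apply: (le_trans _ (@powR1D_add_le R _ _ _ D0 (enorm_ge0 (x - y)) nu0 nu1)).
  rewrite ge0_ler_powR ?nnegrE ?(addr_ge0 D0) ?enorm_ge0//.
  rewrite (le_trans _ (lerD x0D (lexx _)))//.
  by rewrite (le_trans _ (enormD _ _))// addrA subrK.
have := ler_wpM2r (enorm_ge0 (x - y)) xG.
have := normr_dot_le (grad f x) (y - x).
rewrite ler_norml (enormB y x) => /andP[+ _].
have := ler_wpM2l k00 x0y; move: ma; rewrite /hifbe_model; clear.
move: (enorm (x0 - y)) (enorm (x - y)) (dot (grad f x) (y - x)) => s t dx.
move: (s `^ (1 + nu)) (t `^ (1 + nu)) => *; lra.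
Qed.

Lemma hifbe_model_le p gamma f F G D x y : 0 <= p -> 0 < gamma ->
  f x <= F -> enorm (grad f x) <= G -> enorm (x - y) <= D ->
  hifbe_model p gamma f x y <= F + G * D + (p * gamma)^-1 * D `^ p.
Proof.
move=> p0 gamma0 fF xG xyD; have D0 := le_trans (enorm_ge0 _) xyD.
rewrite /hifbe_model !lerD//.
  by rewrite (le_trans (dot_le _ _))// (enormB y x) ler_pM ?enorm_ge0.
rewrite ler_wpM2l ?invr_ge0 ?mulr_ge0 ?(ltW gamma0)//.
by rewrite ge0_ler_powR ?nnegrE ?enorm_ge0.
Qed.

End Model.

(** * Constants uniform over the ball and the Hölder estimate *)

Theorem theorem20 (R : realType) (n : nat) (nu p L : R)
    (f : 'rV[R]_n -> R) (g : 'rV[R]_n -> \bar R)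
    (nu_gt0 : 0 < nu) (nu_le1 : nu <= 1) (p_def : p = 1 + nu)
    (f_diff : forall x, differentiable f x)
    (L_ge0 : 0 <= L) (f_holder : holder_gradient nu L f)
    (g_Nninfty : forall y, (g y != -oo)%E)
    (g_proper : proper_fun g)
    (g_lsc : lower_semicontinuous g)
    (g_prox : prox_bounded p g)
    (g_thr : (0 < prox_threshold p g)%E) :
  forall r : R, 0 < r ->
  exists gbar : R,
    [/\ 0 < gbar, (gbar%:E < prox_threshold p g)%E &
      forall gamma : R, 0 < gamma -> gamma < gbar ->
        [/\ forall x, eball 0 r x -> hifbe p gamma f g x \is a fin_num,
            exists2 Lr : R, 0 < Lr &
              forall x z, eball 0 r x -> eball 0 r z ->
                `|fine (hifbe p gamma f g z) - fine (hifbe p gamma f g x)|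
                  <= Lr * enorm (z - x) `^ nu
          & holder_continuous_on nu (eball 0 r)
              (fun x => fine (hifbe p gamma f g x))]].
Proof.
subst p; have p0 : 0 < 1 + nu by rewrite ltr_pwDl// ltW.
have [gamma0 [gamma0_gt0 [x0 x0_inf]]] := g_prox.
have [m m_le] : exists m : R, forall y,
    (m%:E <= g y + (((1 + nu) * gamma0)^-1 * enorm (x0 - y) `^ (1 + nu))%:E)%E.
  have [m m_le] : exists m : R, (m%:E <= moreau_env (1 + nu) gamma0 g x0)%E.
    (* If the infimum is [+oo], any real lower bound serves. *)
    case: (moreau_env _ _ _ _) x0_inf => [m _|_|//]; first by exists m.
    by exists 0; rewrite leey.
  exists m => y; apply: le_trans m_le _.
  by apply: ereal_inf_lbound; exists y.
set k0 := ((1 + nu) * gamma0)^-1 in m_le.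
have k0_ge0 : 0 <= k0 by rewrite invr_ge0 ltW// mulr_gt0.
(* Below half of [gamma0] one has [k > 2 * k0], the coercivity needed; half also makes the bound
   strict against the threshold. This choice is independent of [r]. *)
move=> r r0; exists (gamma0 / 2); split; first by rewrite divr_gt0.
  have half_lt : ((gamma0 / 2)%:E < gamma0%:E)%E by rewrite lte_fin; lra.
  apply: lt_le_trans half_lt _.
  by apply: ereal_sup_ubound; exists gamma0 => //; split=> //; exists x0.
move=> gamma gamma_gt0 gamma_lt.
pose k := ((1 + nu) * gamma)^-1.
have c_gt0 : 0 < k - 2 * k0.
  rewrite subr_gt0 /k /k0 !invfM mulrCA ltr_pM2l ?invr_gt0//.
  by rewrite -[2]invrK -invfM ltf_pV2 ?posrE ?mulr_gt0// mulrC.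
pose G := enorm (grad f 0) + L * r `^ nu.
have G_ge0 : 0 <= G by rewrite addr_ge0 ?enorm_ge0// mulr_ge0// powR_ge0.
have grad_le x : enorm x < r -> enorm (grad f x) <= G.
  by move=> /ltW; apply: grad_bounded => //; exact: ltW.
have enorm0_lt : enorm (0 : 'rV[R]_n) < r.
  by rewrite -(scale0r 0) enormZ normr0 mul0r.
have f_lip x z : enorm x < r -> enorm z < r -> `|f z - f x| <= G * enorm (z - x).
  exact: lipschitz_on_ball.
pose F := `|f 0| + G * r.
have f_le x : enorm x < r -> `|f x| <= F.
  move=> xr; rewrite -[f x](subrK (f 0)) addrC.
  rewrite (le_trans (ler_normD _ _))// lerD2l.
  by rewrite (le_trans (f_lip _ _ _ _))// subr0 ler_wpM2l// ltW.
have [y0 /fineK gy0] := g_proper.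
pose D0 := enorm y0 + r.
(* [B] bounds the objective at the fixed point [y0] for every [x] in the ball; the added 1 makes the
   bound on the envelope strict. *)
pose B := fine (g y0) + (F + G * D0 + k * D0 `^ (1 + nu)) + 1.
pose A := m - 2 * k0 * (enorm x0 + r) `^ (1 + nu) - F.
have lower x y : enorm x < r ->
    ((A + ((k - 2 * k0) * enorm (x - y) `^ (1 + nu) - G * enorm (x - y)))%:E
     <= g y + (hifbe_model (1 + nu) gamma f x y)%:E)%E.
  move=> xr; have x0x : enorm (x0 - x) <= enorm x0 + r.
    by rewrite (le_trans (enormD _ _))// enormN lerD2l ltW.
  apply: le_trans (hifbe_model_ge nu f g gamma k0 m _ G x0 x y
    nu_gt0 nu_le1 k0_ge0 x0x (grad_le _ xr) (m_le y)).
  rewrite lee_fin lerD2r lerD2l.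
  by have := f_le _ xr; rewrite ler_norml => /andP[].
have upper x : enorm x < r -> (hifbe (1 + nu) gamma f g x < B%:E)%E.
  move=> xr; rewrite hifbeE.
  apply: (@le_lt_trans _ _ (g y0 + (hifbe_model (1 + nu) gamma f x y0)%:E)%E).
    by apply: ereal_inf_lbound; exists y0.
  rewrite -gy0 -EFinD lte_fin ltr_pwDr// lerD2l.
  rewrite hifbe_model_le ?(ltW p0) ?grad_le//.
    exact: le_trans (ler_norm _) (f_le _ xr).
  by rewrite (le_trans (enormD _ _))// enormN addrC lerD2l ltW.
have [mc mc_le] := powR1D_bounded_below (k - 2 * k0) G nu c_gt0 G_ge0 nu_gt0.
(* Any [y] with objective below [B] at [x] lies within [T] of [x], since [A] is the constant part of
   the lower bound. *)
have [T T_ge] := powR1D_coercive (k - 2 * k0) G nu (B - A) c_gt0 G_ge0 nu_gt0.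
have fin x : enorm x < r -> hifbe (1 + nu) gamma f g x \is a fin_num.
  move=> xr; rewrite fin_numE; apply/andP; split; last first.
    by rewrite -ltey (lt_trans (upper _ xr))// ltry.
  rewrite -ltNye; apply: (@lt_le_trans _ _ (A + mc)%:E); first exact: ltNyr.
  rewrite hifbeE; apply/ereal_infP => _ [y _ <-]; apply: le_trans (lower x y xr).
  by rewrite lee_fin lerD2l mc_le// enorm_ge0.
(* The constant of [hifbe_model_holder], with [r + r] bounding the distance between points of the
   ball. *)
pose K := 2 * G * (r + r) `^ (1 - nu) + L * (T + (r + r))
  + k * (T + (r + r) + (r + r) `^ (1 - nu) * T `^ nu).
have step x z : enorm x < r -> enorm z < r ->
    fine (hifbe (1 + nu) gamma f g z) - fine (hifbe (1 + nu) gamma f g x)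
      <= K * enorm (z - x) `^ nu.
  move=> xr zr; apply: fineB_le (fin _ zr) (fin _ xr) _; rewrite !hifbeE.
  apply: (@ereal_inf_le_sublevel _ _ _ _ B); first by rewrite -hifbeE upper.
  move=> y yB; apply: leeD2l_EFin.
  apply: hifbe_model_holder => //; first exact: grad_le.
  - exact: le_trans (ler_norm _) (f_lip _ _ xr zr).
  - by rewrite (le_trans (enormD _ _))// enormN ltW// ltrD.
  apply: T_ge; first exact: enorm_ge0.
  have := le_lt_trans (lower x y xr) yB; rewrite lte_fin => /ltW; lra.
(* The sign of [T], hence of [K], has not been recorded; this choice is positive and dominates
   [K]. *)
pose Lr := 1 + `|K|.
have Lr_gt0 : 0 < Lr by rewrite ltr_pwDl.
have holder x z : enorm x < r -> enorm z < r ->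
    `|fine (hifbe (1 + nu) gamma f g z) - fine (hifbe (1 + nu) gamma f g x)|
      <= Lr * enorm (z - x) `^ nu.
  have KLr : K <= Lr by rewrite ler_wpDl// ler_norm.
  have KLr_mul a : K * a `^ nu <= Lr * a `^ nu by rewrite ler_wpM2r ?powR_ge0.
  (* The one-sided estimate is used twice, with [x] and [z] exchanged. *)
  move=> xr zr; rewrite ler_norml lerNl opprB.
  apply/andP; split; last exact: le_trans (step x z xr zr) (KLr_mul _).
  rewrite (enormB z x); exact: le_trans (step z x zr xr) (KLr_mul _).
split=> [x|| ].
- by rewrite /eball /= subr0; exact: fin.
- by exists Lr => // x z; rewrite /eball /= !subr0; exact: holder.
- by exists Lr; [exact: ltW|move=> x z; rewrite /eball /= !subr0; exact: holder].
Qed.
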